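(* Consider the system $x_{t+1}=f(x_t,w_t)$ with state space $X$, where the initial distribution $\pi_0$ of $x_0$ is stationary and ergodic under the Markov chain $(x_t)_{t\in\mathbb{Z}_+}$, and let $\mu$ be the associated shift-invariant law on $X^{\mathbb{Z}_+}$. Consider state estimation over a noiseless channel with the following objective (E2) for given $\varepsilon>0$: $$P\Bigl(\limsup_{t\to\infty}d(x_t,\hat x_t)\le\varepsilon\Bigr)=1.$$ Let $C_0$ be the smallest channel capacity above which (E2) can be achieved for every $\varepsilon>0$. If $\operatorname{supp}\mu$ is compact, then $$C_0\ \ge\ h_\mu(\theta),$$ where $h_\mu(\theta)$ is the metric (Kolmogorov–Sinai) entropy of the left shift $\theta$ on $X^{\mathbb{Z}_+}$ with respect to $\mu$.
   Context: All logarithms (including in entropies) are to base 2; $\mathbb{Z}_+=\{0,1,2,\dots\}$. System: $(X,d)$ is a complete metric space, $W$ is a measurable space, $f:X\times W\to X$ is Borel measurable and $f_w:=f(\cdot,w):X\to X$ is a homeomorphism for every $w\in W$. $(w_t)_{t\in\mathbb{Z}_+}$ is an i.i.d. sequence in $W$ with common law $\nu$, independent of $x_0\sim\pi_0$. With $f^x(w):=f(x,w)$, the Markov chain $(x_t)$ has transition kernel $P(B|x)=\nu((f^x)^{-1}(B))$. Shift system: $X^{\mathbb{Z}_+}$ carries the product topology, metrized by $D(\bar x,\bar y)=\sum_{t\ge0}2^{-t}\frac{d(x_t,y_t)}{1+d(x_t,y_t)}$; $\theta:X^{\mathbb{Z}_+}\to X^{\mathbb{Z}_+}$, $(\theta\bar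 x)_t=x_{t+1}$. The measure $\mu$ is the $\theta$-invariant Borel probability measure given on cylinder sets by $$\mu(B_0\times\cdots\times B_n\times X\times X\times\cdots)=\int_{B_0\times\cdots\times B_n}\pi_0(\mathrm{d}x_0)P(\mathrm{d}x_1|x_0)\cdots P(\mathrm{d}x_n|x_{n-1}).$$ Coding and estimation: a noiseless channel with finite alphabet $\mathcal{M}=\{1,\dots,M\}$ delivers each input symbol $q_t\in\mathcal{M}$ unaltered ($q'_t=q_t$) and has capacity $\log|\mathcal{M}|$. A coding policy is a sequence of (measurable) maps with $q_t=\gamma^e_t(x_{[0,t]},q'_{[0,t-1]})\in\mathcal{M}$; an estimation policy is a sequence of maps with $\hat x_t=\gamma^d_t(q'_{[0,t]})\in X$. Here $z_{[0,t]}=(z_0,\dots,z_t)$. $C_0$ is the infimum of the capacities $\log|\mathcal{M}|$ of noiseless channels over which, for every $\varepsilon>0$, there exist coding and estimation policies achieving the objective with that $\varepsilon$ ($C_0=\infty$ if there are none). *)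

(* Defs.v *)
From HB Require Import structures.
From mathcomp Require Import all_boot all_order all_algebra.
From mathcomp Require Import all_classical all_reals all_analysis.

Set Implicit Arguments.
Unset Strict Implicit.
Unset Printing Implicit Defensive.

Import Order.TTheory GRing.Theory Num.Theory.
Import numFieldNormedType.Exports.

Local Open Scope classical_set_scope.
Local Open Scope ring_scope.

#[short(type="completeMetricType")]
HB.structure Definition CompleteMetric (R : numDomainType) :=
  {T of Metric R T & Complete T}.

HB.instance Definition _ (I : Type) (T : I -> ptopologicalType) :=
  Pointed.copy (prod_topology T) (forall i, T i).

Notation borel T := (g_sigma_algebraType (@open T)).

Definition log2 {R : realType} (x : R) : R := ln x / ln 2.

Definition homeomorphism {S T : topologicalType} (g : S -> T) :=
  continuous g /\ exists h : T -> S, [/\ cancel g h, cancel h g & continuous h].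

Definition supp {R : realType} {T : ptopologicalType}
    (mu : set (borel T) -> \bar R) : set T :=
  [set x | forall U : set T, open U -> U x -> (0 < mu U)%E].

Definition left_shift {X : Type} (x : {ptws nat -> X}) : {ptws nat -> X} :=
  fun t => x t.+1.

Section metric_entropy.
Context {d : measure_display} {T : measurableType d} {R : realType}.
Variables (mu : set T -> \bar R) (g : T -> T).

Definition invariant_measure :=
  forall B, measurable B -> mu (g @^-1` B) = mu B.

Definition finite_partition (k : nat) (A : 'I_k -> set T) :=
  [/\ forall i, measurable (A i), trivIset [set: 'I_k] A &
      \bigcup_i A i = [set: T]].

(* Cell of label a in the join of the partitions g^{-i} A, 0 <= i < n. *)
Definition join_cell (k : nat) (A : 'I_k -> set T) (n : nat)
    (a : {ffun 'I_n -> 'I_k}) : set T :=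
  \bigcap_(i in [set: 'I_n]) (iter i g @^-1` A (a i)).

(* Empty or null cells contribute 0, since 0 * log2 0 = 0 here. *)
Definition join_entropy (k : nat) (A : 'I_k -> set T) (n : nat) : R :=
  - \sum_(a : {ffun 'I_n -> 'I_k})
      fine (mu (join_cell A a)) * log2 (fine (mu (join_cell A a))).

Definition partition_entropy (k : nat) (A : 'I_k -> set T) : R :=
  limn (fun n => join_entropy A n / n%:R).

Definition metric_entropy : \bar R :=
  ereal_sup [set h | exists (k : nat) (A : 'I_k -> set T),
    finite_partition A /\ h = (partition_entropy A)%:E].

End metric_entropy.

Section markov_chain.
Context {R : realType} {X : ptopologicalType}
  {dW : measure_display} {W : measurableType dW}.
Variables (f : X -> W -> X) (nu : set W -> \bar R).
Local Open Scope ereal_scope.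

(* P(.|x), the law of f(x, w) for w distributed as nu *)
Definition transition (x : X) : set (borel X) -> \bar R :=
  pushforward nu (f x : W -> borel X).

Definition stationary (pi0 : set (borel X) -> \bar R) :=
  forall B : set (borel X), measurable B ->
    \int[pi0]_x transition x B = pi0 B.

Definition ergodic (pi0 : set (borel X) -> \bar R) :=
  forall B : set (borel X), measurable B ->
    pi0.-negligible [set x | transition x B != (\1_B x)%:E] ->
    pi0 B = 0 \/ pi0 B = 1.

(* Iterated integral of the kernel started at x over B_1 x ... x B_n. *)
Fixpoint kernel_cylinder (Bs : seq (set (borel X))) (x : X) : \bar R :=
  if Bs is B :: Bs' then
    \int[transition x]_(y in B) kernel_cylinder Bs' y
  else 1.

Definition cylinder (Bs : seq (set X)) : set {ptws nat -> X} :=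
  [set x | forall i, (i < size Bs)%N -> nth setT Bs i (x i)].

Definition path_law (pi0 : set (borel X) -> \bar R)
    (mu : set (borel {ptws nat -> X}) -> \bar R) :=
  forall (B0 : set (borel X)) (Bs : seq (set (borel X))),
    measurable B0 -> (forall B, B \in Bs -> measurable B) ->
    mu (cylinder (B0 :: Bs)) = \int[pi0]_(x in B0) kernel_cylinder Bs x.

End markov_chain.

Fixpoint trajectory {X W : Type} (f : X -> W -> X) (x0 : X) (w : nat -> W)
    (t : nat) : X :=
  if t is t'.+1 then f (trajectory f x0 w t') (w t') else x0.

(* x0 has law pi0, the w_t have law nu, and x0, w_0, w_1, ... are mutually
   independent. Taking B or some of the C i to be the full space gives the
   product rule for arbitrary finite subfamilies. *)
Definition driving_noise {R : realType}
    {dO : measure_display} {Omega : measurableType dO} (Pr : set Omega -> \bar R)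
    {dX : measure_display} {X : measurableType dX} (pi0 : set X -> \bar R)
    {dW : measure_display} {W : measurableType dW} (nu : set W -> \bar R)
    (x0 : Omega -> X) (w : nat -> Omega -> W) :=
  [/\ measurable_fun [set: Omega] x0,
      forall t, measurable_fun [set: Omega] (w t),
      forall B : set X, measurable B -> Pr (x0 @^-1` B) = pi0 B,
      forall t (C : set W), measurable C -> Pr (w t @^-1` C) = nu C &
      forall (n : nat) (B : set X) (C : 'I_n -> set W),
        measurable B -> (forall i, measurable (C i)) ->
        Pr (x0 @^-1` B `&` \bigcap_(i in [set: 'I_n]) (w i @^-1` C i)) =
          (Pr (x0 @^-1` B) * \prod_(i < n) Pr (w i @^-1` C i))%E].

(* The channel is noiseless, so its outputs q' are identified with its inputs q;
   the alphabet {1, ..., M} is represented by 'I_M. *)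
Section policies.
Context {X : ptopologicalType} {M : nat}.

Definition coding_policy := forall t : nat, t.+1.-tuple X -> t.-tuple 'I_M -> 'I_M.

Definition estimation_policy := forall t : nat, t.+1.-tuple 'I_M -> X.

(* Tuples carry the product of the Borel sigma-algebras. Estimation policies
   have finite discrete domains, so they need no measurability condition. *)
Definition measurable_coding (gammae : coding_policy) :=
  forall (t : nat) (q : t.-tuple 'I_M) (m : 'I_M),
    measurable [set x : t.+1.-tuple (borel X) | gammae t x q = m].

Variables (gammae : coding_policy) (gammad : estimation_policy) (x : nat -> X).

(* q_[0, t-1] *)
Fixpoint symbols (t : nat) : t.-tuple 'I_M :=
  if t is t'.+1 then
    [tuple of rcons (symbols t')
                    (gammae [tuple x i | i < t'.+1] (symbols t'))]
  else [tuple].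

Definition estimate (t : nat) : X := gammad (symbols t.+1).

End policies.
Arguments coding_policy : clear implicits.
Arguments estimation_policy : clear implicits.

Section capacity.
Context {R : realType} {X : completeMetricType R}
  {dO : measure_display} {Omega : measurableType dO}.
Variables (Pr : set Omega -> \bar R) (x : nat -> Omega -> X).
Local Open Scope ereal_scope.

Definition objective_E2 (M : nat) (gammae : coding_policy X M)
    (gammad : estimation_policy X M) (eps : R) :=
  Pr [set om | limn_esup (fun t =>
        (mdist (x t om) (estimate gammae gammad (x ^~ om) t))%:E) <= eps%:E] = 1.

Definition achievable (M : nat) :=
  forall eps : R, (0 < eps)%R ->
    exists (gammae : coding_policy X M) (gammad : estimation_policy X M),
      measurable_coding gammae /\ objective_E2 gammae gammad eps.

(* ereal_inf set0 = +oo *)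
Definition C0 : \bar R :=
  ereal_inf [set c | exists M : nat,
    [/\ (0 < M)%N, achievable M & c = (log2 (M%:R : R))%:E]].

End capacity.

(* Main.v *)
Require Import Defs.
From mathcomp Require Import all_boot all_order all_algebra.
From mathcomp Require Import zify ring lra.
From mathcomp Require Import all_classical all_reals all_analysis.
From mathcomp Require Import measurable_realfun.
Import Order.TTheory GRing.Theory Num.Theory.
Local Open Scope classical_set_scope.
Local Open Scope ring_scope.

Set Implicit Arguments.
Unset Strict Implicit.
Import numFieldNormedType.Exports.
(** Fix a channel with M symbols over which the objective is achievable for
    every accuracy, and a finite Borel partition A of the path space.  The
    claim is that the entropy H_n of the n-step itinerary of a mu-random path
    with respect to A satisfies limsup H_n / n <= log M.

    A decoder that has read N symbols has produced one of M ^ N finite lists of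
    estimates.  Eventual accuracy says that, up to small probability, from some
    time T on the true path stays e-close to one of these lists, for all N at
    once with the same T (achievable_covered).  The itinerary can then be read
    off the estimates: up to small mu-measure, the cell of A that contains a
    path is determined by finitely many coordinates of the path known with a
    fixed accuracy (partition_label), because every Borel set can be
    approximated from inside, together with its complement, by two uniformly
    separated sets (borel_splits).  So there are M ^ (n + m) codewords of length
    n such that a typical itinerary is within small Hamming distance of one of
    them; the expected distance is at most T + 2 d n, with d as small as
    desired, because mu is shift invariant (join_entropy_le_codebook).

    The entropy of such a source is bounded through the Gibbs inequality: in
    natural logarithms, H_n is at most the mean of - ln Q for any probability Q on words, and for Q the
    output law of a slightly noisy symmetric channel fed with a uniformly
    chosen codeword, - ln Q (a) is at most ln (M ^ (n + m)) + n s + h L, where h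
    is the Hamming distance from a to the nearest codeword, s is as small as
    desired and L depends on s and the number of cells only (entropy_codebook).
    Choosing s first and then d with d L small gives the claim.

    The estimation objective speaks of the process driven by x0 and the noise,
    whereas the entropy speaks of mu.  The two laws agree on the sigma-algebra
    generated by cylinders (path_distribution), by the Markov property
    (state_cylinder_prob).  This suffices even where the Borel sigma-algebra of
    the product is larger: the event that a path is close to one of finitely
    many lists belongs to the cylinder sigma-algebra, and the approximation of
    the cells of A is carried out under mu alone. *)

(** * Uniformly separated approximation of Borel sets of paths *)

Lemma continuous_borel_measurable (S T : ptopologicalType) (g : S -> T) :
  continuous g -> measurable_fun [set: borel S] (g : borel S -> borel T).
Proof.
move=> /continuousP cg.
apply: (@measurability _ _ (borel S) (borel T) _ _ (@open T)) => //.
move=> _ [U oU <-]; rewrite setTI; apply: sub_sigma_algebra; exact: cg.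
Qed.

Lemma measurable_coordinate (X : ptopologicalType) (t : nat) :
  measurable_fun [set: borel {ptws nat -> X}]
    ((fun x => x t) : borel {ptws nat -> X} -> borel X).
Proof.
by apply: continuous_borel_measurable; exact: (@proj_continuous nat (fun=> X) t).
Qed.

Lemma iter_left_shift (X : Type) (n : nat) (x : {ptws nat -> X}) (t : nat) :
  iter n left_shift x t = x (n + t)%N.
Proof. by elim: n t => //= n IH t; rewrite /left_shift IH addnS. Qed.

Section separation.
Context {R : realType} {X : completeMetricType R}.

Lemma measurable_iter_left_shift (n : nat) :
  measurable_fun [set: borel {ptws nat -> X}]
    (iter n left_shift : borel {ptws nat -> X} -> borel {ptws nat -> X}).
Proof.
apply: continuous_borel_measurable => x.
apply/pointwise_cvgP => t.
suff : (fun y : {ptws nat -> X} => iter n left_shift y t) @ x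
    --> iter n left_shift x t by [].
rewrite iter_left_shift.
rewrite (_ : (fun y : {ptws nat -> X} => iter n left_shift y t) =
  (fun y : {ptws nat -> X} => y (n + t)%N)); last first.
  by apply/funext => y; rewrite iter_left_shift.
exact: (@proj_continuous nat (fun=> X) (n + t)%N x).
Qed.

Lemma metric_ball_open (x : X) (r : R) : open (ball x r).
Proof.
rewrite openE => y; rewrite ballEmdist/= => xy.
apply/nbhs_ballP; exists (r - mdist x y) => /=; first by rewrite subr_gt0.
move=> z; rewrite ballEmdist/= => yz.
by rewrite (le_lt_trans (metric_triangle _ y _))// -ltrBrDl.
Qed.

(** The uniform structure of the product: a gap of size e in one of the first
    m coordinates, with m and e the same for all pairs of points. *)
Definition separated (m : nat) (e : R) (Z Z' : set {ptws nat -> X}) :=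
  forall z z', Z z -> Z' z' -> exists2 t, (t < m)%N & e <= mdist (z t) (z' t).

(** The points whose basic neighbourhood of order n lies in U. The order n
    plays two roles, number of coordinates and accuracy 1 / (n + 1), so that
    the sets increase with n. *)
Definition deep_part (U : set {ptws nat -> X}) (n : nat) : set {ptws nat -> X} :=
  [set x | forall y : {ptws nat -> X},
     (forall t, (t < n)%N -> mdist (x t) (y t) < n.+1%:R^-1) -> U y].

Lemma deep_part_sub U n : deep_part U n `<=` U.
Proof. by move=> x; apply => t _; rewrite mdistxx invr_gt0 ltr0n. Qed.

Lemma deep_part_separated U n : separated n n.+1%:R^-1 (deep_part U n) (~` U).
Proof.
move=> z z' Zz Uz'; apply: contrapT => H; apply: Uz'; apply: Zz => t tn.
by rewrite ltNge; apply/negP => le; apply: H; exists t.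
Qed.

Lemma deep_part_closed U n : open (~` deep_part U n).
Proof.
rewrite (_ : ~` _ = \bigcup_(y in ~` U) \bigcap_(t in `I_n)
   ((fun x : {ptws nat -> X} => x t) @^-1` ball (y t) n.+1%:R^-1)).
  apply: bigcup_open => y _; rewrite bigcap_mkord.
  apply: big_ind => [||t _]; [exact: openT|exact: openI|].
  apply: open_comp => [x _|]; first exact: (@proj_continuous nat (fun=> X) t).
  exact: metric_ball_open.
apply/seteqP; split => [x /existsNP[y /not_implyP[H Uy]]|x [y Uy H] D].
  by exists y => // t tn; rewrite /preimage/= ballEmdist/= metric_sym; exact: H.
by apply: Uy; apply: D => t /H; rewrite /preimage/= ballEmdist/= metric_sym.
Qed.

(** Otherwise some x in U is the limit of points y n outside U, with y n
    within 1 / (n + 1) of x in the first n coordinates. *)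
Lemma deep_part_exhaust U : open U -> \bigcup_n deep_part U n = U.
Proof.
move=> oU; apply/seteqP; split => [x [n _ /deep_part_sub//]|x Ux].
apply: contrapT => H.
have /choice[y Hy] : forall n, exists y : {ptws nat -> X},
    (forall t, (t < n)%N -> mdist (x t) (y t) < n.+1%:R^-1) /\ ~ U y.
  move=> n; apply: contrapT => Hn; apply: H; exists n => // y Hy.
  by apply: contrapT => Uy; apply: Hn; exists y.
have : y @ \oo --> x.
  apply/pointwise_cvgP => t; apply/cvg_ballP => e e0.
  suff : \forall n \near \oo, mdist (x t) (y n t) < e.
    by apply: filterS => n /=; rewrite /fmap/= ballEmdist.
  near=> n; apply: (@lt_trans _ _ n.+1%:R^-1).
    by apply: (proj1 (Hy n)); near: n; exact: nbhs_infty_gt.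
  near: n; exact: near_infty_natSinv_lt (PosNum e0).
move=> /(_ U (open_nbhs_nbhs (conj oU Ux))) [n _ /(_ n (leqnn n))/=].
by have [] := Hy n.
Unshelve. all: by end_near. Qed.

Lemma measure_exhaust d (T : measurableType d) (mu : probability T R)
    (F : nat -> set T) (B : set T) (e : R) :
  0 < e -> (forall n, measurable (F n)) ->
  (forall n m, (n <= m)%N -> F n `<=` F m) -> \bigcup_n F n = B ->
  exists n, (mu (B `\` F n) < e%:E)%E.
Proof.
move=> e0 mF ndF FB.
have mB : measurable B by rewrite -FB; exact: bigcupT_measurable.
have I0 : \bigcap_n (B `\` F n) = set0.
  apply/seteqP; split => // x H.
  have [Bx _] := H 0%N I; move: (Bx); rewrite -FB => -[n _ Fx].
  by have [] := H n I.
have : mu \o (fun n => B `\` F n) @ \oo --> mu (\bigcap_n (B `\` F n)).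
  apply: nonincreasing_cvg_mu.
  - by rewrite (le_lt_trans (probability_le1 _ _))// ?ltry//; exact: measurableD.
  - by move=> n; exact: measurableD.
  - by rewrite I0.
  - by move=> n m nm; apply/subsetPset; apply: setDS; exact: ndF.
rewrite I0 measure0 => /(_ [set y | (y < e%:E)%E]) [].
  apply: open_nbhs_nbhs; split; first exact: open_ereal_lt_ereal.
  by rewrite /= lte_fin.
by move=> n _ /(_ n (leqnn n)) /= ?; exists n.
Qed.

(** A form of inner regularity adapted to coordinatewise estimates: B and its
    complement contain uniformly separated sets that together carry almost
    all the mass. *)
Definition splits (mu : probability (borel {ptws nat -> X}) R)
    (B : set {ptws nat -> X}) :=
  forall d : R, 0 < d -> exists (m : nat) (e : R) (Z Z' : set (borel {ptws nat -> X})),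
    [/\ 0 < e, measurable Z /\ measurable Z', Z `<=` B /\ Z' `<=` ~` B,
        separated m e Z Z' & (mu (~` (Z `|` Z')) < d%:E)%E].

Lemma separatedS m m' e e' Z Z' : (m <= m')%N -> e' <= e ->
  separated m e Z Z' -> separated m' e' Z Z'.
Proof.
move=> mm ee S z z' Zz Zz'; have [t tm le] := S z z' Zz Zz'.
by exists t; [exact: leq_trans mm|exact: le_trans le].
Qed.

Lemma separatedC m e Z Z' : separated m e Z Z' -> separated m e Z' Z.
Proof.
by move=> S z z' Zz Zz'; have [t tm] := S z' z Zz' Zz; rewrite metric_sym; exists t.
Qed.

Lemma splits0 mu : splits mu set0.
Proof.
move=> d d0; exists 0%N, 1, set0, setT; split => //.
  by split => // x _ [].
rewrite (_ : ~` _ = set0) ?measure0 ?lte_fin//.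
by apply/seteqP; split => // x H; apply: H; right.
Qed.

Lemma splitsC mu B : splits mu B -> splits mu (~` B).
Proof.
move=> S d /S[m [e [Z [Z' [e0 [mZ mZ'] [ZB ZB'] sep small]]]]].
exists m, e, Z', Z; split => //; last by rewrite setUC.
  by rewrite setCK.
exact: separatedC.
Qed.

Lemma splitsU mu A B : splits mu A -> splits mu B -> splits mu (A `|` B).
Proof.
move=> SA SB d d0; have d20 : 0 < d / 2 by rewrite divr_gt0.
have [m [e [Z [Z' [e0 [mZ mZ'] [ZB ZB'] sep small]]]]] := SA _ d20.
have [n [f [Y [Y' [f0 [mY mY'] [YB YB'] sep' small']]]]] := SB _ d20.
exists (maxn m n), (Num.min e f), (Z `|` Y), (Z' `&` Y'); split.
- by rewrite lt_min e0.
- by split; [exact: measurableU|exact: measurableI].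
- by split; [exact: setUSS|rewrite setCU; exact: setISS].
- move=> z z' [Zz [Zz' _]|Yz [_ Yz']].
  + by apply: (separatedS _ _ sep) Zz Zz'; rewrite ?leq_maxl// ge_min lexx.
  + by apply: (separatedS _ _ sep') Yz Yz'; rewrite ?leq_maxr// ge_min lexx orbT.
- have mC : measurable (~` (Z `|` Z')) by apply: measurableC; exact: measurableU.
  have mC' : measurable (~` (Y `|` Y')) by apply: measurableC; exact: measurableU.
  rewrite (splitr d) EFinD.
  apply: (le_lt_trans _ (lteD small small')).
  apply: (le_trans _ (measureU2 mu mC mC')); apply: le_measure; rewrite ?inE.
  + by apply: measurableC; apply: measurableU; [exact: measurableU|exact: measurableI].
  + exact: measurableU.
  + rewrite -setCI; apply: subsetC => x [[?|?] [?|?]]; rewrite /setU/setI/=; tauto.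
Qed.

Lemma splits_open mu (U : set {ptws nat -> X}) : open U -> splits mu U.
Proof.
move=> oU d d0.
have mD n : measurable (deep_part U n : set (borel {ptws nat -> X})).
  rewrite -[deep_part U n]setCK; apply: measurableC.
  by apply: sub_sigma_algebra; exact: deep_part_closed.
have ndD n m : (n <= m)%N -> deep_part U n `<=` deep_part U m.
  move=> nm x Dx y Hy; apply: Dx => t tn.
  apply: (lt_le_trans (Hy t (leq_trans tn nm))).
  by rewrite lef_pV2 ?posrE ?ltr0n// ler_nat ltnS.
have [n small] := measure_exhaust mu d0 mD ndD (deep_part_exhaust oU).
exists n, n.+1%:R^-1, (deep_part U n), (~` U); split => //.
- split => //; apply: measurableC; exact: sub_sigma_algebra.
- by split => //; exact: deep_part_sub.
- exact: deep_part_separated.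
- by rewrite setCU setCK setIC.
Qed.

(** Up to small measure the union is the finite union U n. A pair of sets
    that works for U n also works for the whole union, once the second set is
    cut down to the complement of the union; this loses only the union minus
    U n. *)
Lemma splits_bigcup mu (B : nat -> set (borel {ptws nat -> X})) :
  (forall n, measurable (B n)) -> (forall n, splits mu (B n)) ->
  splits mu (\bigcup_n B n).
Proof.
move=> mB SB d d0; have d20 : 0 < d / 2 by rewrite divr_gt0.
pose U n : set (borel {ptws nat -> X}) := \big[setU/set0]_(i < n) B i.
have mU n : measurable (U n) by apply: bigsetU_measurable.
have SU n : splits mu (U n).
  by elim/big_ind : (U n) => [|? ? |i _]; [exact: splits0|exact: splitsU|exact: SB].
have ndU n m : (n <= m)%N -> U n `<=` U m by exact: subset_bigsetU.
have UB : \bigcup_n U n = \bigcup_n B n.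
  apply/seteqP; split => x [n _]; rewrite ?/U -?bigcup_mkord.
    by move=> [i _ Bx]; exists i.
  by move=> Bx; exists n.+1 => //; rewrite /U -bigcup_mkord; exists n => /=.
have [n smalln] := measure_exhaust mu d20 mU ndU UB.
have [m [e [Z [Z' [e0 [mZ mZ'] [ZB ZB'] sep small]]]]] := SU n _ d20.
have mBB : measurable (\bigcup_n B n) by exact: bigcupT_measurable.
exists m, e, Z, (Z' `&` ~` \bigcup_n B n); split => //.
- by split=> //; apply: measurableI => //; exact: measurableC.
- split; last by move=> x [].
  by apply: (subset_trans ZB); rewrite -UB; exact: bigcup_sup.
- by move=> z z' Zz [Zz' _]; exact: sep.
- have mC : measurable (~` (Z `|` Z')) by apply: measurableC; exact: measurableU.
  have mD : measurable (\bigcup_n B n `\` U n) by exact: measurableD.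
  rewrite (splitr d) EFinD.
  apply: (le_lt_trans _ (lteD small smalln)).
  apply: (le_trans _ (measureU2 mu mC mD)); apply: le_measure; rewrite ?inE.
  + apply: measurableC; apply: measurableU => //; apply: measurableI => //.
    exact: measurableC.
  + exact: measurableU.
  + move=> x H; case: (pselect (Z' x)) => [Z'x|nZ'x].
      right; split; last by move=> Ux; exact: (ZB' x Z'x).
      by apply: contrapT => nBx; apply: H; right.
    by left => -[Zx|//]; apply: H; left.
Qed.

(** The sets that split form a sigma-algebra; an open set belongs to it
    because its deep parts increase to it. *)
Lemma borel_splits mu (B : set (borel {ptws nat -> X})) :
  measurable B -> splits mu B.
Proof.
move=> mB; suff : <<s @open {ptws nat -> X} >> `<=`
    [set B : set (borel {ptws nat -> X}) | measurable B /\ splits mu B].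
  by move=> /(_ B mB)[].
apply: smallest_sub.
  split => [|A [mA SA]|A HA].
  - by split; [exact: measurable0|exact: splits0].
  - by rewrite setTD; split; [exact: measurableC|exact: splitsC].
  - split; first by apply: bigcupT_measurable => n; have [] := HA n.
    by apply: splits_bigcup => n; have [] := HA n.
by move=> U oU; split; [exact: sub_sigma_algebra|exact: splits_open].
Qed.

(** This turns estimates into labels: for points of Z, being e-close in the
    first m coordinates forces being in the same cell. *)
Lemma partition_label (mu : probability (borel {ptws nat -> X}) R)
    (k : nat) (A : 'I_k -> set (borel {ptws nat -> X})) (d : R) :
  (forall i, measurable (A i)) -> 0 < d ->
  exists (m : nat) (e : R) (Z : set (borel {ptws nat -> X})),
    [/\ 0 < e, measurable Z, (mu (~` Z) < d%:E)%E &
      forall z z' i, Z z -> Z z' ->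
        (forall t, (t < m)%N -> mdist (z t) (z' t) < e) -> A i z -> A i z'].
Proof.
move=> mA d0.
suff : forall j (d : R), 0 < d ->
    exists (m : nat) (e : R) (Z : set (borel {ptws nat -> X})),
    [/\ 0 < e, measurable Z, (mu (~` Z) < d%:E)%E &
      forall z z' (i : 'I_k), (i < j)%N -> Z z -> Z z' ->
        (forall t, (t < m)%N -> mdist (z t) (z' t) < e) -> A i z -> A i z'].
  move=> /(_ k d d0)[m [e [Z [e0 mZ small HZ]]]].
  by exists m, e, Z; split => // z z' i; exact: HZ.
elim=> [|j IH] {d0}d d0.
  exists 0%N, 1, setT; split => //.
  rewrite (_ : ~` _ = set0) ?measure0 ?lte_fin//.
   exact: setCT.
have [jk|kj] := ltnP j k; last first.
  have [m [e [Z [e0 mZ small HZ]]]] := IH d d0.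
  exists m, e, Z; split => // z z' i _; apply: HZ.
  exact: leq_trans (ltn_ord i) kj.
have d20 : 0 < d / 2 by rewrite divr_gt0.
have [m [e [Z [e0 mZ small HZ]]]] := IH _ d20.
have [n [f [Y [Y' [f0 [mY mY'] [YA YA'] sep small']]]]] :=
  borel_splits mu (mA (Ordinal jk)) d20.
have mYY : measurable (Y `|` Y') by exact: measurableU.
exists (maxn m n), (Num.min e f), (Z `&` (Y `|` Y')); split.
- by rewrite lt_min e0.
- exact: measurableI.
- rewrite setCI (splitr d) EFinD.
  apply: (le_lt_trans _ (lteD small small')).
  by apply: measureU2; exact: measurableC.
- move=> z z' i; rewrite ltnS leq_eqVlt => /orP[/eqP ij|ij]
    [Zz Yz] [Zz' Yz'] H; last first.
    apply: HZ => // t tm; apply: (lt_le_trans (H t _)).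
      by rewrite leq_max tm.
    by rewrite ge_min lexx.
  have -> : i = Ordinal jk by exact: val_inj.
  move=> Az; have {}Yz : Y z by case: Yz => // /YA'.
  case: Yz' => [/YA//|Yz'].
  have [t tn] := sep _ _ Yz Yz'.
  rewrite leNgt => /negP[]; apply: (lt_le_trans (H t _)).
    by rewrite leq_max tn orbT.
  by rewrite ge_min lexx orbT.
Qed.

End separation.

(** * Entropy of a source that stays close to a codebook *)

Section codebook.
Context {R : realType}.

(** The inequality ln (1 + x) <= x at x = q / p - 1; at p = 0 the term p * ln
    p is 0. *)
Lemma gibbs_term (p q : R) : 0 <= p -> 0 < q ->
  - (p * ln p) <= - (p * ln q) + (q - p).
Proof.
rewrite le_eqVlt => /predU1P[<- q0|p0 q0].
  by rewrite !mul0r !oppr0 add0r addr0 ltW.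
have : ln (1 + (q / p - 1)) <= q / p - 1.
  by apply: le_ln1Dx; rewrite ltrBrDl subrr divr_gt0.
rewrite addrC subrK ln_div ?posrE// => /(ler_wpM2l (ltW p0)).
rewrite !mulrBr mulr1 mulrCA divff ?gt_eqF// mulr1; lra.
Qed.

Lemma gibbs_inequality (I : finType) (p q : I -> R) :
  (forall i, 0 <= p i) -> (forall i, 0 < q i) -> \sum_i q i <= \sum_i p i ->
  - \sum_i p i * ln (p i) <= - \sum_i p i * ln (q i).
Proof.
move=> p0 q0 qp; rewrite -!sumrN.
apply: (@le_trans _ _ (\sum_i (- (p i * ln (q i)) + (q i - p i)))).
  by apply: ler_sum => i _; exact: gibbs_term.
by rewrite big_split/= gerDl sumrB subr_le0.
Qed.

Definition hamming (k n : nat) (a b : {ffun 'I_n -> 'I_k}) : nat :=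
  #|[pred t | a t != b t]|.

Variables (k n : nat) (C : finType) (c : C -> {ffun 'I_n -> 'I_k.+1}) (eta : R).

(** The probability that a symmetric channel outputs i on input j, when the
    input is replaced with probability eta by a uniformly chosen letter. *)
Definition noisy_symbol (i j : 'I_k.+1) : R :=
  (1 - eta) * (i == j)%:R + eta / k.+1%:R.

(** The law of the output of this channel, used n times, when the input is a
    uniformly chosen codeword. *)
Definition noisy_codebook (a : {ffun 'I_n -> 'I_k.+1}) : R :=
  \sum_(u : C) #|C|%:R^-1 * \prod_(t < n) noisy_symbol (a t) (c u t).

Hypotheses (Cpos : (0 < #|C|)%N) (eta0 : 0 < eta) (eta1 : eta < 1).

Lemma noisy_symbol_gt0 i j : 0 < noisy_symbol i j.
Proof.
apply: ltr_wpDl; first by rewrite mulr_ge0// subr_ge0 ltW.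
by rewrite divr_gt0.
Qed.

Lemma sum_noisy_symbol j : \sum_i noisy_symbol i j = 1.
Proof.
rewrite big_split/= -mulr_sumr sumr_const card_ord -[X in _ + X]mulr_natr.
rewrite divfK ?pnatr_eq0// (bigD1 j)//= eqxx big1 ?addr0 ?mulr1 ?subrK//.
by move=> i /negPf ->.
Qed.

Lemma sum_noisy_codebook : \sum_a noisy_codebook a = 1.
Proof.
rewrite exchange_big/=.
under eq_bigr => u _.
  rewrite -mulr_sumr -(bigA_distr_bigA (fun t j => noisy_symbol j (c u t))).
  rewrite big1; last by move=> t _; exact: sum_noisy_symbol.
  over.
by rewrite sumr_const mulr1 -[LHS]mulr_natr mulVf// pnatr_eq0 -lt0n.
Qed.

Lemma noisy_codebook_gt0 a : 0 < noisy_codebook a.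
Proof.
have /card_gt0P[u0 _] := Cpos.
rewrite /noisy_codebook (bigD1 u0)//=; apply: ltr_pwDl.
  rewrite mulr_gt0 ?invr_gt0 ?ltr0n//.
  by apply: prodr_gt0 => t _; exact: noisy_symbol_gt0.
apply: sumr_ge0 => u _; rewrite mulr_ge0//.
by apply: prodr_ge0 => t _; rewrite ltW// noisy_symbol_gt0.
Qed.

(** Keep the term of u only. Each factor is at least 1 - eta where a agrees
    with the codeword, and at least eta / k.+1 elsewhere. *)
Lemma noisy_codebook_ge a u :
  - ln (noisy_codebook a) <= ln #|C|%:R + n%:R * - ln (1 - eta)
    + (hamming a (c u))%:R * ln (k.+1%:R / eta).
Proof.
have eta1' : 0 < 1 - eta by rewrite subr_gt0.
have etak : 0 < eta / k.+1%:R by rewrite divr_gt0.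
have P0 : 0 < (1 - eta) ^+ n * (eta / k.+1%:R) ^+ hamming a (c u).
  by rewrite mulr_gt0// exprn_gt0.
have Cinv : 0 < #|C|%:R^-1 :> R by rewrite invr_gt0 ltr0n.
have : #|C|%:R^-1 * ((1 - eta) ^+ n * (eta / k.+1%:R) ^+ hamming a (c u))
    <= noisy_codebook a.
  rewrite /noisy_codebook (bigD1 u)//=.
  apply: (@le_trans _ _ (#|C|%:R^-1 * \prod_(t < n) noisy_symbol (a t) (c u t))); last first.
    rewrite lerDl; apply: sumr_ge0 => v _; rewrite mulr_ge0//.
    by apply: prodr_ge0 => t _; rewrite ltW// noisy_symbol_gt0.
  rewrite ler_wpM2l ?(ltW Cinv)//.
  have -> : (1 - eta) ^+ n * (eta / k.+1%:R) ^+ hamming a (c u) =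
    \prod_(t < n) ((1 - eta) * (if a t != c u t then eta / k.+1%:R else 1)).
    rewrite big_split/= prodr_const card_ord -big_mkcond/= prodr_const.
    by [].
  apply: ler_prod => t _; rewrite /noisy_symbol.
  case: eqP => /= _; rewrite ?mulr1 ?mulr0 ?add0r.
    by rewrite ltW//= lerDl ltW.
  by rewrite mulr_ge0 ?(ltW etak) ?(ltW eta1')//=
    ler_piMl ?(ltW etak)// lerBlDl lerDr ltW.
rewrite -(ler_ln (_ : _ \is Num.pos) (_ : _ \is Num.pos))
  ?posrE ?noisy_codebook_gt0 ?mulr_gt0 ?exprn_gt0//.
rewrite lnM ?posrE// lnM ?posrE ?exprn_gt0// lnV ?posrE ?ltr0n// !lnXn//.
rewrite -[in X in X <= _](invf_div k.+1%:R eta) lnV ?posrE ?divr_gt0//.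
rewrite mulNrn -![ln _ *+ _]mulr_natl; lra.
Qed.

(** The Gibbs inequality applied to the law noisy_codebook. It plays the role
    of the Fano inequality, with the expected Hamming distance to the
    codebook as error term. *)
Lemma entropy_codebook (p : {ffun 'I_n -> 'I_k.+1} -> R)
    (mis : {ffun 'I_n -> 'I_k.+1} -> nat) :
  (forall a, 0 <= p a) -> \sum_a p a = 1 ->
  (forall a, exists u, (hamming a (c u) <= mis a)%N) ->
  - \sum_a p a * ln (p a) <= ln #|C|%:R + n%:R * - ln (1 - eta)
    + (\sum_a p a * (mis a)%:R) * ln (k.+1%:R / eta).
Proof.
move=> p0 p1 Hmis.
apply: (le_trans (gibbs_inequality p0 noisy_codebook_gt0 _)).
  by rewrite sum_noisy_codebook p1.
set K := ln #|C|%:R + _.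
have -> : K = \sum_a p a * K by rewrite -mulr_suml p1 mul1r.
rewrite mulr_suml -big_split/= -sumrN.
apply: ler_sum => a _; rewrite -mulrN -mulrA -mulrDr ler_wpM2l//.
have [u Hu] := Hmis a; apply: (le_trans (noisy_codebook_ge a u)).
rewrite lerD2l ler_wpM2r ?ler_nat// ln_ge0// ler_pdivlMr// mul1r.
by rewrite (le_trans (ltW eta1))// ler1n.
Qed.

End codebook.

(** * Itineraries of a measure-preserving map *)

Lemma integral_sum_indic d (T : measurableType d) (R : realType)
    (mu : probability T R) (I : Type) (r : seq I) (al : I -> R) (S : I -> set T) :
  (forall i, 0 <= al i) -> (forall i, measurable (S i)) ->
  (\int[mu]_x (\sum_(i <- r) al i * \1_(S i) x)%:E =
   (\sum_(i <- r) al i * fine (mu (S i)))%:E)%E.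
Proof.
move=> al0 mS.
under eq_integral => x _ do rewrite -sumEFin.
rewrite ge0_integral_sum//; last 2 first.
- by move=> i; apply/measurable_EFinP; apply: measurable_funM.
- by move=> i x _; rewrite lee_fin mulr_ge0.
rewrite -sumEFin; apply: eq_bigr => i _.
under eq_integral => x _ do rewrite EFinM.
rewrite ge0_integralZl_EFin//.
  by rewrite integral_indic// setIT EFinM fineK// fin_num_measure.
by apply/measurable_EFinP; exact: measurable_indic.
Qed.

(** Integrate both sides. *)
Lemma le_sum_indic d (T : measurableType d) (R : realType)
    (mu : probability T R) (I J : Type) (r : seq I) (s : seq J)
    (al : I -> R) (be : J -> R) (S : I -> set T) (B : J -> set T) :
  (forall i, 0 <= al i) -> (forall i, measurable (S i)) ->
  (forall j, 0 <= be j) -> (forall j, measurable (B j)) ->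
  (forall x, \sum_(i <- r) al i * \1_(S i) x <= \sum_(j <- s) be j * \1_(B j) x) ->
  \sum_(i <- r) al i * fine (mu (S i)) <= \sum_(j <- s) be j * fine (mu (B j)).
Proof.
move=> al0 mS be0 mB le; rewrite -lee_fin -!integral_sum_indic//.
have m K (q : seq K) (ga : K -> R) (D : K -> set T) : (forall i, measurable (D i)) ->
    measurable_fun [set: T] (fun x => (\sum_(i <- q) ga i * \1_(D i) x)%:E).
  move=> mD; apply/measurable_EFinP; apply: measurable_sum => i.
  exact: measurable_funM.
apply: ge0_le_integral => //; [|exact: m|exact: m|] => x _; rewrite lee_fin//.
by apply: sumr_ge0 => i _; rewrite mulr_ge0.
Qed.

Section itinerary.
Context {d : measure_display} {T : measurableType d} {R : realType}.
Variables (mu : probability T R) (g : T -> T) (k : nat) (A : 'I_k.+1 -> set T).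
Hypotheses (mg : measurable_fun [set: T] g) (inv : invariant_measure mu g).
Hypothesis partA : finite_partition A.

Lemma measurable_iter_preimage n (B : set T) :
  measurable B -> measurable (iter n g @^-1` B).
Proof.
move=> mB; elim: n => [//|n IH].
rewrite (_ : _ @^-1` _ = g @^-1` (iter n g @^-1` B)).
  by rewrite -[X in measurable X]setTI; exact: mg.
by apply/funext => x; rewrite /preimage/= -iterS iterSr.
Qed.

Lemma invariant_iter n (B : set T) :
  measurable B -> mu (iter n g @^-1` B) = mu B.
Proof.
move=> mB; elim: n => [//|n IH].
rewrite (_ : _ @^-1` _ = g @^-1` (iter n g @^-1` B)).
  by rewrite inv//; exact: measurable_iter_preimage.
by apply/funext => x; rewrite /preimage/= -iterS iterSr.
Qed.

Lemma measurable_join_cell n (a : {ffun 'I_n -> 'I_k.+1}) :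
  measurable (join_cell g A a).
Proof.
case: partA => mA _ _; apply: fin_bigcap_measurable => // i _.
exact: measurable_iter_preimage.
Qed.

Lemma partition_labelling : exists lab : T -> 'I_k.+1, forall x i, A i x <-> i = lab x.
Proof.
case: partA => mA tA cA.
have /choice[lab Hlab] : forall x, exists i, A i x.
  by move=> x; have : [set: T] x by []; rewrite -cA => -[i _ Ax]; exists i.
exists lab => x i; split => [Ax|->//].
by apply: (tA i (lab x)) => //; exists x.
Qed.

(** The distance from the itinerary of x to the nearest codeword is at most n
    for x outside G. For x in G, the codeword may be wrong at time t only if
    t < T0 or if the orbit is outside Z at time t, which has the same
    probability for every t by invariance. *)
Lemma join_entropy_le_codebook (n T0 : nat) (C : finType)
    (c : C -> {ffun 'I_n -> 'I_k.+1}) (Z G : set T) (eta : R) :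
  measurable Z -> measurable G -> 0 < eta -> eta < 1 -> (0 < #|C|)%N ->
  (forall x, G x -> exists u, forall t : 'I_n, (T0 <= t)%N ->
     Z (iter t g x) -> A (c u t) (iter t g x)) ->
  join_entropy mu g A n <= (ln #|C|%:R + n%:R * - ln (1 - eta) +
    (T0%:R + n%:R * fine (mu (~` Z)) + n%:R * fine (mu (~` G))) *
    ln (k.+1%:R / eta)) / ln 2.
Proof.
move=> mZ mG eta0 eta1 Cpos HG.
have [lab Hlab] := partition_labelling.
pose word x : {ffun 'I_n -> 'I_k.+1} := [ffun t : 'I_n => lab (iter t g x)].
have cellE (a : {ffun 'I_n -> 'I_k.+1}) x : join_cell g A a x <-> a = word x.
  split => [H|-> t _]; last by apply/Hlab; rewrite ffunE.
  by apply/ffunP => t; rewrite ffunE; apply/Hlab; exact: H.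
have cell1 (a : {ffun 'I_n -> 'I_k.+1}) x : \1_(join_cell g A a) x = (a == word x)%:R :> R.
  rewrite indicE; congr (_%:R); congr nat_of_bool.
  by apply/idP/eqP => [/set_mem/cellE//|/cellE/mem_set].
have /card_gt0P[u0 _] := Cpos.
pose mis (a : {ffun 'I_n -> 'I_k.+1}) : nat := hamming a (c [arg min_(u < u0) hamming a (c u)]).
have mis_le a u : (mis a <= hamming a (c u))%N.
  by rewrite /mis; case: arg_minnP => // v _; apply.
have sum1 : \sum_(a : {ffun 'I_n -> 'I_k.+1}) fine (mu (join_cell g A a)) = 1.
  have -> : \sum_(a : {ffun 'I_n -> 'I_k.+1}) fine (mu (join_cell g A a)) =
      \sum_(a : {ffun 'I_n -> 'I_k.+1}) 1 * fine (mu (join_cell g A a)).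
    by apply: eq_bigr => a _; rewrite mul1r.
  apply: EFin_inj; rewrite -integral_sum_indic//; last exact: measurable_join_cell.
  under eq_integral => x _.
    rewrite (bigD1 (word x))//= cell1 eqxx mulr1 big1 ?addr0; last first.
      by move=> a /negPf; rewrite cell1 => ->; rewrite mulr0.
    over.
  by rewrite integral_cst// mul1e; exact: probability_setT.
have le : \sum_(a : {ffun 'I_n -> 'I_k.+1}) fine (mu (join_cell g A a)) * (mis a)%:R <=
    T0%:R + n%:R * fine (mu (~` Z)) + n%:R * fine (mu (~` G)).
  (* The three kinds of errors: None for times before T0, Some None for the
     complement of G, Some (Some t) for an orbit outside Z at time t. *)
  pose be (j : option (option 'I_n)) : R :=
    if j is Some j' then if j' is Some _ then 1 else n%:R else T0%:R.
  pose B (j : option (option 'I_n)) : set T :=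
    if j is Some j' then if j' is Some t then iter t g @^-1` (~` Z) else ~` G else setT.
  pose s := [:: None, Some None & [seq Some (Some t) | t <- index_enum 'I_n]].
  have -> : T0%:R + n%:R * fine (mu (~` Z)) + n%:R * fine (mu (~` G)) =
      \sum_(j <- s) be j * fine (mu (B j)).
    rewrite !big_cons big_map/= probability_setT mulr1.
    rewrite (eq_bigr (fun=> fine (mu (~` Z)))); last first.
      by move=> t _; rewrite mul1r invariant_iter//; exact: measurableC.
    by rewrite sumr_const card_ord -[_ *+ n]mulr_natl; ring.
  under eq_bigr => a _ do rewrite mulrC.
  apply: le_sum_indic => //.
  - exact: measurable_join_cell.
  - by move=> [[t|]|].
  - move=> [[t|]|]//=; last exact: measurableC.
    by apply: measurable_iter_preimage; exact: measurableC.
  move=> x; rewrite !big_cons big_map/= indicT mulr1.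
  rewrite (bigD1 (word x))//= cell1 eqxx mulr1 big1 ?addr0; last first.
    by move=> a /negPf; rewrite cell1 => ->; rewrite mulr0.
  have [Gx|nGx] := pselect (G x); last first.
    rewrite indicE mem_set// mulr1.
    apply: (@le_trans _ _ n%:R).
      rewrite ler_nat; apply: (leq_trans (mis_le _ u0)).
      by rewrite (leq_trans (max_card _))// card_ord.
    by rewrite addrCA lerDl addr_ge0// sumr_ge0.
  rewrite indicE memNset; last by apply.
  rewrite mulr0 add0r.
  have [u Hu] := HG x Gx.
  apply: (@le_trans _ _ (hamming (word x) (c u))%:R); first by rewrite ler_nat.
  apply: (@le_trans _ _ (\sum_(t < n) ((t < T0)%N%:R + 1 * \1_(iter t g @^-1` (~` Z)) x))).
    rewrite /hamming -sum1_card natr_sum big_mkcond/=.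
    apply: ler_sum => t _; rewrite mul1r; case: ifPn => [|_]; last by rewrite addr_ge0.
    rewrite inE => neq; have [tT|Tt] := ltnP t T0; first by rewrite lerDl.
    rewrite add0r indicE mem_set// => Zx.
    by move/negP: neq; apply; rewrite ffunE; apply/eqP/esym/Hlab; exact: Hu.
  rewrite big_split/= lerD2r -natr_sum ler_nat.
  suff -> : (\sum_(t < n) (t < T0))%N = minn n T0 by rewrite geq_minr.
  elim: {word cellE cell1 mis mis_le sum1 be B s Hu HG c u0} n => [|n IH].
    by rewrite big_ord0 min0n.
  by rewrite big_ord_recr/= IH; case: ltnP; lia.
have ln2 : 0 < ln 2 :> R by rewrite ln_gt0// ltr1n.
rewrite ler_pdivlMr// /join_entropy mulNr mulr_suml.
under eq_bigr => a _ do rewrite /log2 -mulrA divfK ?gt_eqF//.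
apply: (le_trans (@entropy_codebook R k n C c eta Cpos eta0 eta1
  (fun a : {ffun 'I_n -> 'I_k.+1} => fine (mu (join_cell g A a))) mis _ sum1 _)).
- by move=> a; exact: fine_ge0.
- by move=> a; eexists; exact: leqnn.
rewrite lerD2l ler_wpM2r// ln_ge0// ler_pdivlMr// mul1r.
by rewrite (le_trans (ltW eta1))// ler1n.
Qed.

End itinerary.

(** * Entropy of the shift when paths are covered by codes *)

(** When the sequence does not converge, its limit is by convention the
    default value 0; hence the hypothesis 0 <= b. *)
Lemma partition_entropy_le d (T : measurableType d) (R : realType)
    (mu : set T -> \bar R) (g : T -> T) (k : nat) (A : 'I_k -> set T) (b : R) :
  0 <= b ->
  (forall s, 0 < s -> \forall n \near \oo, join_entropy mu g A n / n%:R <= b + s) ->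
  partition_entropy mu g A <= b.
Proof.
move=> b0 H; apply/ler_addgt0Pr => s s0; rewrite /partition_entropy.
have [cv|ncv] := pselect (cvgn (fun n => join_entropy mu g A n / n%:R)).
  by apply: limr_le => //; exact: H.
by rewrite (dvgP ncv) addr_ge0// ltW.
Qed.

(** Up to mass d, every path is e-close, between times T and N, to one of M ^
    N reference paths. That T does not depend on N is what makes the first T
    symbols negligible as N grows. *)
Definition covered_by_codes {R : realType} {X : completeMetricType R}
    (mu : set (borel {ptws nat -> X}) -> \bar R) (M : nat) :=
  forall e d : R, 0 < e -> 0 < d -> exists T : nat, forall N : nat,
  exists (C : finType) (y : C -> nat -> X) (G : set (borel {ptws nat -> X})),
    [/\ #|C| = (M ^ N)%N, measurable G, (mu (~` G) <= d%:E)%E &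
      forall x, G x -> exists u, forall t, (T <= t < N)%N ->
        mdist (x t) (y u t) < e].

(** An itinerary of length n is decoded from n + m reference positions, since
    a label depends on m consecutive coordinates. Hence the M ^ (n + m)
    codewords, a rate log M in the limit. *)
Lemma partition_entropy_le_log {R : realType} {X : completeMetricType R}
    (mu : probability (borel {ptws nat -> X}) R) (M k : nat)
    (A : 'I_k.+1 -> set (borel {ptws nat -> X})) :
  invariant_measure mu left_shift -> finite_partition A -> (0 < M)%N ->
  covered_by_codes mu M -> partition_entropy mu left_shift A <= log2 M%:R.
Proof.
move=> inv partA M0 cov.
have ln2 : 0 < ln 2 :> R by rewrite ln_gt0// ltr1n.
have lnM : 0 <= ln M%:R :> R by rewrite ln_ge0// ler1n.
apply: partition_entropy_le => [|s' s'0]; first by rewrite divr_ge0// ltW.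
pose s := s' * ln 2 / 3.
have s0 : 0 < s by rewrite divr_gt0// mulr_gt0.
(* This makes - ln (1 - eta) equal to s; d is then chosen so that the two
   terms n d L below contribute n s in total. *)
pose eta := 1 - expR (- s).
have eta1 : eta < 1 by rewrite ltrBlDr ltrDl expR_gt0.
have eta0 : 0 < eta by rewrite subr_gt0 expR_lt1 oppr_lt0.
pose L := ln (k.+1%:R / eta).
have L0 : 0 < L.
  rewrite ln_gt0// ltr_pdivlMr// mul1r (lt_le_trans eta1)// ler1n//.
pose d := s / (2 * L).
have d0 : 0 < d by rewrite divr_gt0// mulr_gt0.
case: (partA) => mA _ _.
have [m [e [Z [e0 mZ smallZ HZ]]]] := partition_label mu mA d0.
have e20 : 0 < e / 2 by rewrite divr_gt0.
have [T HT] := cov _ _ e20 d0.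
have [lab Hlab] := partition_labelling partA.
have mshift : measurable_fun [set: borel {ptws nat -> X}]
    (left_shift : borel {ptws nat -> X} -> borel {ptws nat -> X}).
  exact: (measurable_iter_left_shift 1).
have bound n : join_entropy mu left_shift A n <=
    ((n + m)%:R * ln M%:R + n%:R * s + (T%:R + n%:R * d + n%:R * d) * L) / ln 2.
  have [C [y [G [cardC mG smallG HG]]]] := HT (n + m)%N.
  have Cpos : (0 < #|C|)%N by rewrite cardC expn_gt0 M0.
  (* Two points of Z close to the same window of a reference path are close
     to each other, hence have the same label; lb picks that label, or ord0
     when no point of Z is close. *)
  pose near_code u t (z : {ptws nat -> X}) :=
    Z z /\ forall j, (j < m)%N -> mdist (z j) (y u (t + j)%N) < e / 2.
  have /choice[lb Hlb] : forall ut : C * 'I_n, exists i : 'I_k.+1,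
      forall z, near_code ut.1 ut.2 z -> A i z.
    move=> [u t] /=; have [[z0 [Zz0 Hz0]]|none] := pselect (exists z, near_code u t z).
      exists (lab z0) => z [Zz Hz].
      apply: (HZ z0) => //; last exact/Hlab.
      move=> j jm; rewrite (splitr e).
      apply: (le_lt_trans (metric_triangle _ (y u (t + j)%N) _)).
      by rewrite ltrD ?Hz0// metric_sym Hz.
    by exists ord0 => z Hz; case: none; exists z.
  pose c u : {ffun 'I_n -> 'I_k.+1} := [ffun t => lb (u, t)].
  apply: (le_trans (@join_entropy_le_codebook _ _ _ mu _ k A mshift inv partA
    n T C c Z G eta mZ mG eta0 eta1 Cpos _)).
    move=> x Gx; have [u Hu] := HG x Gx; exists u => t Tt Zx.
    rewrite ffunE; apply: (Hlb (u, t)); split => // j jm /=.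
    rewrite iter_left_shift; apply: Hu.
    by rewrite (leq_trans Tt (leq_addr _ _)) /= -addnS leq_add// ltnW.
  rewrite ler_pM2r ?invr_gt0// cardC natrX lnXn ?ltr0n//.
  rewrite -[ln _ *+ _]mulr_natl /eta subKr expRK opprK lerD2l ler_pM2r//.
  have fZ : fine (mu (~` Z)) <= d.
    by rewrite -lee_fin fineK ?ltW// fin_num_measure//; exact: measurableC.
  have fG : fine (mu (~` G)) <= d.
    by rewrite -lee_fin fineK// fin_num_measure//; exact: measurableC.
  by rewrite !lerD// ler_wpM2l.
have dL : d * L = s / 2.
  by rewrite /d; field; rewrite gt_eqF.
pose K := m%:R * ln M%:R + T%:R * L.
near=> n.
have n0 : 0 < n%:R :> R by rewrite ltr0n; near: n; exact: nbhs_infty_gt.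
rewrite ler_pdivrMr//; apply: (le_trans (bound n)).
rewrite ler_pdivrMr//.
have Kn : K <= n%:R * s.
  rewrite -ler_pdivrMr//; near: n; exact: nbhs_infty_ger.
have -> : (ln M%:R / ln 2 + s') * n%:R * ln 2 = (ln M%:R + 3 * s) * n%:R.
  by rewrite /s; field; rewrite gt_eqF.
have -> : (T%:R + n%:R * d + n%:R * d) * L = T%:R * L + 2 * n%:R * (d * L).
  by ring.
rewrite dL natrD.
move: Kn; rewrite /K; lra.
Unshelve. all: by end_near. Qed.

(** * Law of the trajectory *)

(** The pair (Y, U) has the product law, so this is the Tonelli theorem. *)
Lemma ge0_integral_independent d1 d2 d3 (Omega : measurableType d1)
    (S : measurableType d2) (V : measurableType d3) (R : realType)
    (Pr : probability Omega R) (nu : probability V R)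
    (Y : Omega -> S) (U : Omega -> V) (h : S * V -> \bar R) :
  measurable_fun [set: Omega] Y -> measurable_fun [set: Omega] U ->
  (forall A B, measurable A -> measurable B ->
     Pr (Y @^-1` A `&` U @^-1` B) = (Pr (Y @^-1` A) * nu B)%E) ->
  measurable_fun [set: S * V] h -> (forall z, (0 <= h z)%E) ->
  (\int[Pr]_om h (Y om, U om) = \int[Pr]_om \int[nu]_v h (Y om, v))%E.
Proof.
move=> mY mU ind mh h0.
pose Y' : {mfun Omega >-> S} := mfun_Sub (mem_set mY).
have mYU : measurable_fun [set: Omega] (fun om => (Y om, U om)).
  exact: measurable_fun_pair.
have -> : (\int[Pr]_om h (Y om, U om))%E =
    (\int[pushforward Pr (fun om => (Y om, U om))]_z h z)%E.
  by rewrite ge0_integral_pushforward.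
rewrite (eq_measure_integral (distribution Pr Y' \x nu)%E); last first.
  by move=> A mA _; apply/esym; apply: product_measure_unique.
rewrite fubini_tonelli1// ge0_integral_distribution//.
- exact: measurable_fun_fubini_tonelli_F.
- by move=> y; apply: integral_ge0.
Qed.

Section noise.
Context {R : realType} {X : ptopologicalType}
  {dW : measure_display} {W : measurableType dW}
  {dO : measure_display} {Omega : measurableType dO}.
Variables (f : X -> W -> X) (nu : probability W R) (pi0 : probability (borel X) R)
  (Pr : probability Omega R) (x0 : Omega -> X) (w : nat -> Omega -> W).
Hypothesis mf : measurable_fun [set: borel X * W]
  ((fun p => f p.1 p.2) : borel X * W -> borel X).
Hypothesis noise : driving_noise Pr pi0 nu (x0 : Omega -> borel X) w.

Let x (t : nat) (om : Omega) : X := trajectory f (x0 om) (w ^~ om) t.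

(** The rectangles that generate the sigma-algebra of the initial state and
    of the noise before time t. *)
Definition past_rectangle (t : nat) : set (set Omega) :=
  [set E | exists (B : set (borel X)) (C : nat -> set W),
    [/\ measurable B, forall i, measurable (C i) &
        E = x0 @^-1` B `&` \bigcap_(i in `I_t) (w i @^-1` C i)]].

Let past t := <<s past_rectangle t>>.

Lemma measurable_past_rectangle t : past_rectangle t `<=` measurable.
Proof.
case: noise => mx0 mw _ _ _ _ [B [C [mB mC ->]]].
apply: measurableI; first by rewrite -[X in measurable X]setTI; exact: mx0.
apply: fin_bigcap_measurable => [|i _]; first exact: finite_II.
by rewrite -[X in measurable X]setTI; exact: mw.
Qed.

Lemma past_measurable t E : past t E -> measurable E.
Proof.
apply: smallest_sub; last exact: measurable_past_rectangle.
exact: sigma_algebra_measurable.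
Qed.

Lemma past_setI t E F : past t E -> past t F -> past t (E `&` F).
Proof. exact: (@measurableI _ (g_sigma_algebraType (past_rectangle t))). Qed.

Lemma past_rectangleT t : past_rectangle t setT.
Proof.
exists setT, (fun=> setT); split => //.
by rewrite preimage_setT setTI; apply/seteqP; split.
Qed.

Lemma past_rectangleI t : setI_closed (past_rectangle t).
Proof.
move=> _ _ [B [C [mB mC ->]]] [B' [C' [mB' mC' ->]]].
exists (B `&` B'), (fun i => C i `&` C' i); split.
- exact: measurableI.
- by move=> i; exact: measurableI.
- by rewrite preimage_setI bigcapI setIACA.
Qed.

Lemma past_rectangle_widen s t : (s <= t)%N -> past_rectangle s `<=` past_rectangle t.
Proof.
move=> st _ [B [C [mB mC ->]]].
exists B, (fun i => if (i < s)%N then C i else setT); split => //.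
  by move=> i; case: ifP.
congr (_ `&` _); apply/seteqP; split => [om H i it|om H i /= si].
  by case: ifP => // si; exact: H.
by have := H i (leq_trans si st); rewrite si.
Qed.

Lemma past_widen s t E : (s <= t)%N -> past s E -> past t E.
Proof.
move=> st; apply: smallest_sub => [|D pD]; first exact: smallest_sigma_algebra.
by apply: sub_sigma_algebra; exact: past_rectangle_widen pD.
Qed.

Lemma past_rectangle_noise t E D : past_rectangle t E -> measurable D ->
  Pr (E `&` w t @^-1` D) = (Pr E * nu D)%E.
Proof.
case: noise => _ mw _ Hw Hind [B [C [mB mC ->]]] mD.
(* Independence is applied to the first t + 1 noise variables, with D as the
   last condition. *)
pose C' (i : 'I_t.+1) := if (i < t)%N then C i else D.
have mC' i : measurable (C' i) by rewrite /C'; case: ifP.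
have C'max : C' ord_max = D by rewrite /C' /= ltnn.
have := Hind t.+1 B C' mB mC'; rewrite big_ord_recr/= C'max Hw// muleA.
have := Hind t B (fun i => C' (widen_ord (leqnSn t) i)) mB (fun i => mC' _).
move=> <- Hr; have past_eq : \bigcap_(i in [set: 'I_t])
    (w i @^-1` C' (widen_ord (leqnSn t) i)) = \bigcap_(i in `I_t) (w i @^-1` C i).
  apply/seteqP; split => om H i; last first.
    by move=> _; rewrite /C' /= ltn_ord; exact: (H i (ltn_ord i)).
  by move=> it; have := H (Ordinal it) I; rewrite /C' /= it.
rewrite past_eq in Hr.
rewrite -Hr -setIA; congr (Pr (_ `&` _)).
apply/seteqP; split => [om [H Ht] i _|om H].
  rewrite /C'; case: ltnP => it; first exact: H.
  have -> : nat_of_ord i = t by apply/eqP; rewrite eqn_leq it -ltnS ltn_ord.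
  exact: Ht.
split => [i /= it|]; last by rewrite -C'max; exact: (H ord_max I).
by have := H (widen_ord (leqnSn t) (Ordinal it)) I; rewrite /C' /= it.
Qed.

(** Both sides are finite measures of E, and they agree on past rectangles. *)
Lemma past_noise t E D : past t E -> measurable D ->
  Pr (E `&` w t @^-1` D) = (Pr E * nu D)%E.
Proof.
move=> pE mD; case: (noise) => _ mw _ _ _.
have mwD : measurable (w t @^-1` D).
  by rewrite -[X in measurable X]setTI; exact: mw.
have nuD0 : 0 <= fine (nu D) by exact: fine_ge0.
have scaleE A : mscale (NngNum nuD0) Pr A = (Pr A * nu D)%E.
  by rewrite /mscale/= fineK ?fin_num_measure// muleC.
rewrite -scaleE.
rewrite -[LHS]/(mrestr Pr mwD E).
apply: (g_sigma_algebra_measure_unique (past_rectangle t) _ (fun=> setT)) => //.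
- exact: measurable_past_rectangle.
- by move=> _; exact: past_rectangleT.
- by rewrite bigcup_const.
- exact: past_rectangleI.
- move=> A pA; transitivity (Pr A * nu D)%E; first exact: past_rectangle_noise.
  exact/esym/scaleE.
- move=> k; rewrite /mrestr/= (le_lt_trans (probability_le1 _ _))// ?ltry//.
  exact: measurableI.
Qed.

(** The state at time s is a measurable function of x0 and of the noise at
    times before s. *)
Lemma past_state s t (B : set (borel X)) : (s <= t)%N -> measurable B ->
  past t (x s @^-1` B).
Proof.
case: noise => mx0 mw _ _ _.
have wP i D : (i < t)%N -> measurable D -> past t (w i @^-1` D).
  move=> it mD; apply: sub_sigma_algebra.
  exists setT, (fun j => if j == i then D else setT); split => //.
    by move=> j; case: ifP.
  rewrite preimage_setT setTI; apply/seteqP; split => [om H j _|om H].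
    by case: eqP => // ->.
  by have := H i it; rewrite eqxx.
elim: s B => [|s IH] B st mB.
  apply: sub_sigma_algebra; exists B, (fun=> setT); split => //.
  by rewrite (_ : \bigcap_(_ in _) _ = setT) ?setIT//; apply/seteqP; split.
pose O := g_sigma_algebraType (past_rectangle t).
have mxs : measurable_fun [set: O] (x s : O -> borel X).
  by move=> _ D mD; rewrite setTI; apply: IH => //; exact: ltnW.
have mws : measurable_fun [set: O] (w s : O -> W).
  by move=> _ D mD; rewrite setTI; exact: wP.
have := measurableT_comp mf (measurable_fun_pair mxs mws).
by move=> /(_ measurableT B mB); rewrite setTI.
Qed.

Lemma measurable_state t : measurable_fun [set: Omega] (x t : Omega -> borel X).
Proof.
by move=> _ B mB; rewrite setTI; apply: (@past_measurable t); exact: past_state.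
Qed.

Lemma measurable_fixed_state y : measurable_fun [set: W] (f y : W -> borel X).
Proof.
have -> : f y = (fun p => f p.1 p.2) \o (fun v : W => (y : borel X, v)) by [].
by apply: measurableT_comp mf _; exact: measurable_fun_pair.
Qed.

Lemma integral_transition (phi : borel X -> \bar R) (B : set (borel X)) y :
  measurable B -> measurable_fun [set: borel X] phi -> (forall z, (0 <= phi z)%E) ->
  (\int[transition f nu y]_(z in B) phi z = \int[nu]_v (phi \_ B) (f y v))%E.
Proof.
move=> mB mphi phi0; rewrite /transition ge0_integral_pushforward//.
- by rewrite integral_mkcond; apply: eq_integral => v _; rewrite !patchE.
- exact: measurable_fixed_state.
- exact: measurable_funTS.
Qed.

Lemma kernel_cylinder_ge0 (Bs : seq (set (borel X))) y :
  (0 <= kernel_cylinder f nu Bs y)%E.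
Proof.
elim: Bs y => [|B Bs IH] y //=.
apply: integral_ge0 => [|z _]; last exact: IH.
exact: measurable_fixed_state.
Qed.

Lemma measurable_kernel_cylinder (Bs : seq (set (borel X))) :
  (forall B, B \in Bs -> measurable B) ->
  measurable_fun [set: borel X] (kernel_cylinder f nu Bs).
Proof.
elim: Bs => [|B Bs IH] mBs; first exact: measurable_cst.
have mB : measurable B by apply: mBs; rewrite inE eqxx.
have mK : measurable_fun [set: borel X] (kernel_cylinder f nu Bs).
  by apply: IH => C CBs; apply: mBs; rewrite inE CBs orbT.
have mphi : measurable_fun [set: borel X] (kernel_cylinder f nu Bs \_ B).
  by apply: (iffLR (measurable_restrictT _ mB)); exact: measurable_funTS.
have phi0 z : (0 <= (kernel_cylinder f nu Bs \_ B) z)%E.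
  by rewrite patchE; case: ifP => // _; exact: kernel_cylinder_ge0.
have -> : kernel_cylinder f nu (B :: Bs) =
    fubini_F nu (fun p : borel X * W => (kernel_cylinder f nu Bs \_ B) (f p.1 p.2)).
  by apply/funext => y; rewrite /= integral_transition//; exact: kernel_cylinder_ge0.
by apply: measurable_fun_fubini_tonelli_F => //; exact: measurableT_comp mphi mf.
Qed.

(** The Markov property. The event E only depends on the past of time t, so
    it can absorb the condition on the state at time t; the induction
    hypothesis then applies at time t + 1, and integrating out the noise at
    time t, which is independent of the past, turns the integrand at the next
    state into the kernel at the current one. *)
Lemma state_cylinder_prob t E (B0 : set (borel X)) (Bs : seq (set (borel X))) :
  past t E -> measurable B0 -> (forall B, B \in Bs -> measurable B) ->
  (Pr (E `&` [set om | forall i, (i < (size Bs).+1)%N ->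
         nth setT (B0 :: Bs) i (x (t + i) om)]) =
   \int[Pr]_(om in E `&` x t @^-1` B0) kernel_cylinder f nu Bs (x t om))%E.
Proof.
elim: Bs t E B0 => [|B Bs IH] t E B0 pE mB0 mBs.
  rewrite /= integral_cst ?mul1e//; last first.
    by apply: (@past_measurable t); apply: past_setI => //; exact: past_state.
  congr (Pr (_ `&` _)); apply/seteqP; split => om.
    by move=> /(_ 0%N isT)/=; rewrite addn0.
  by move=> H [|//] _ /=; rewrite addn0.
have mB : measurable B by apply: mBs; rewrite inE eqxx.
have mBs' C : C \in Bs -> measurable C by move=> CBs; apply: mBs; rewrite inE CBs orbT.
pose E' := E `&` x t @^-1` B0.
have pE' : past t E' by apply: past_setI => //; exact: past_state.
have -> : E `&` [set om | forall i, (i < (size (B :: Bs)).+1)%N ->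
      nth setT (B0 :: B :: Bs) i (x (t + i) om)] =
    E' `&` [set om | forall i, (i < (size Bs).+1)%N ->
      nth setT (B :: Bs) i (x (t.+1 + i) om)].
  apply/seteqP; split => om.
    move=> [Eom H]; split => [|i iBs].
      by split => //; have := H 0%N isT; rewrite addn0.
    by have := H i.+1 iBs; rewrite addnS.
  move=> [[Eom B0x] H]; split => // -[|i] iBs; first by rewrite addn0.
  by rewrite addnS; exact: H.
rewrite IH//; last exact: past_widen pE'.
set phi := kernel_cylinder f nu Bs \_ B.
have mK : measurable_fun [set: borel X] (kernel_cylinder f nu Bs).
  exact: measurable_kernel_cylinder.
have mphi : measurable_fun [set: borel X] phi.
  by apply: (iffLR (measurable_restrictT _ mB)); exact: measurable_funTS.
have phi0 z : (0 <= phi z)%E.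
  by rewrite /phi patchE; case: ifP => // _; exact: kernel_cylinder_ge0.
pose O := g_sigma_algebraType (past_rectangle t).
have mxt : measurable_fun [set: O] (x t : O -> borel X).
  by move=> _ D mD; rewrite setTI; apply: past_state.
(* On O, which is Omega with the past sigma-algebra, the identity is a random
   variable independent of w t. *)
pose h (p : O * W) : \bar R := ((\1_E' p.1)%:E * phi (f (x t p.1) p.2))%E.
have mh : measurable_fun [set: O * W] h.
  apply: emeasurable_funM.
    apply/measurable_EFinP.
    have mE : measurable_fun [set: O] (\1_(E' : set O) : O -> R).
      exact: measurable_indic.
    exact: (measurableT_comp mE (@measurable_fst _ _ O W)).
  have mpair : measurable_fun [set: O * W] (fun p : O * W => (x t p.1 : borel X, p.2)).
    apply: measurable_fun_pair; last exact: measurable_snd.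
    exact: (measurableT_comp mxt (@measurable_fst _ _ O W)).
  exact: (measurableT_comp mphi (measurableT_comp mf mpair)).
have h0 z : (0 <= h z)%E by rewrite mule_ge0// lee_fin.
have mid : measurable_fun [set: Omega] (id : Omega -> O).
  by move=> _ D mD; rewrite setTI; exact: (@past_measurable t).
have mwt : measurable_fun [set: Omega] (w t) by case: noise.
have ind (A : set O) D : measurable A -> measurable D ->
    Pr (id @^-1` A `&` w t @^-1` D) = (Pr (id @^-1` A) * nu D)%E.
  by move=> mA mD; exact: past_noise.
transitivity (\int[Pr]_om h (om, w t om))%E.
  rewrite setIC integral_mkcondl [LHS]integral_mkcond; apply: eq_integral => om _.
  rewrite /h /= patchE indicE /phi !patchE /=.
  case: ifPn => _; rewrite ?mul1e ?mul0e//.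
rewrite (ge0_integral_independent mid mwt ind mh h0).
rewrite [RHS]integral_mkcond; apply: eq_integral => om _.
rewrite /h /= patchE indicE; case: ifPn => _.
  under eq_integral => v _ do rewrite mul1e.
  by rewrite /= integral_transition//; exact: kernel_cylinder_ge0.
by under eq_integral => v _ do rewrite mul0e; rewrite integral0.
Qed.

Lemma state_cylinder_law (mu : probability (borel {ptws nat -> X}) R)
    (B0 : set (borel X)) (Bs : seq (set (borel X))) :
  path_law f nu pi0 mu ->
  measurable B0 -> (forall B, B \in Bs -> measurable B) ->
  mu (cylinder (B0 :: Bs)) = Pr [set om | cylinder (B0 :: Bs) (x ^~ om)].
Proof.
move=> law mB0 mBs; rewrite law//.
have mK := measurable_kernel_cylinder mBs.
have := @state_cylinder_prob 0%N setT B0 Bs _ mB0 mBs.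
rewrite !setTI => ->; last by apply: sub_sigma_algebra; exact: past_rectangleT.
rewrite -(@ge0_integral_pushforward _ _ _ _ _ (x 0%N : Omega -> borel X))//.
- case: (noise) => _ _ Hx0 _ _.
  apply: eq_measure_integral => [|mx A mA _]; first exact: measurable_state.
  exact/esym/Hx0.
- exact: measurable_state.
- exact: measurable_funTS.
- by move=> y _; exact: kernel_cylinder_ge0.
Qed.

(** The cylinders with Borel bases generate a sigma-algebra that may be
    strictly smaller than the Borel sigma-algebra of the product. *)
Definition cylinder_sets : set (set {ptws nat -> X}) :=
  [set S | exists (B0 : set (borel X)) (Bs : seq (set (borel X))),
    [/\ measurable B0, forall B, B \in Bs -> measurable B & S = cylinder (B0 :: Bs)]].

Lemma cylinder_coordinate t (B : set (borel X)) : measurable B ->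
  cylinder_sets [set y | B (y t)].
Proof.
move=> mB.
exists (if t is 0%N then B else setT),
  (mkseq (fun i => if i.+1 == t then B else setT) t); split.
- by case: t.
- by move=> C /mapP[i _ ->]; case: ifP.
apply/seteqP; split => y /=.
  move=> By [_|i]; first by case: t By.
  rewrite /= size_mkseq.
  rewrite ltnS => it; rewrite nth_mkseq//; case: eqP => // ->.
  exact: By.
case: t => [|t] H; first exact: (H 0%N isT).
pose F i := if i.+1 == t.+1 then B else setT.
have := H t.+1; rewrite (_ : size _ = t.+2); last by rewrite /= size_map size_iota.
rewrite ltnSn -[nth _ _ _]/(nth setT (mkseq F t.+1) t) nth_mkseq// /F eqxx.
exact.
Qed.

Lemma cylinder_setsI : setI_closed cylinder_sets.
Proof.
move=> _ _ [B0 [Bs [mB0 mBs ->]]] [C0 [Cs [mC0 mCs ->]]].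
have mnth (s : seq (set (borel X))) i :
    (forall B, B \in s -> measurable B) -> measurable (nth setT s i).
  move=> ms; have [si|si] := ltnP i (size s); first by apply: ms; exact: mem_nth.
  by rewrite nth_default.
exists (B0 `&` C0),
  (mkseq (fun i => nth setT Bs i `&` nth setT Cs i) (maxn (size Bs) (size Cs))).
split; first exact: measurableI.
  by move=> B /mapP[i _ ->]; apply: measurableI; exact: mnth.
apply/seteqP; split => y.
  move=> [HB HC] [_|i]; first by split; [exact: (HB 0%N)|exact: (HC 0%N)].
  rewrite /= size_mkseq ltnS => imax; rewrite nth_mkseq//; split.
    have [si|si] := ltnP i (size Bs); first exact: (HB i.+1).
    by rewrite nth_default.
  have [si|si] := ltnP i (size Cs); first exact: (HC i.+1).
  by rewrite nth_default.
move=> H; split => -[|i] /= si; try by have [] := H 0%N isT.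
- rewrite ltnS in si.
  have := H i.+1; rewrite /= size_mkseq ltnS leq_max si => /(_ isT).
  by rewrite nth_mkseq ?leq_max ?si// => -[].
- rewrite ltnS in si.
  have := H i.+1; rewrite /= size_mkseq ltnS leq_max si orbT => /(_ isT).
  by rewrite nth_mkseq ?leq_max ?si ?orbT// => -[].
Qed.

Let P := g_sigma_algebraType cylinder_sets.

Lemma measurable_cylinder_coordinate t :
  measurable_fun [set: P] ((fun y : P => y t) : P -> borel X).
Proof.
by move=> _ B mB; rewrite setTI; apply: sub_sigma_algebra; exact: cylinder_coordinate.
Qed.

Lemma measurable_path : measurable_fun [set: Omega] ((fun om => x ^~ om) : Omega -> P).
Proof.
apply: (@measurability _ _ Omega P _ _ cylinder_sets) => //.
move=> _ [_ [B0 [Bs [mB0 mBs ->]]] <-]; rewrite setTI.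
rewrite (_ : _ @^-1` _ = \bigcap_(i in `I_(size (B0 :: Bs)))
    (x i @^-1` nth setT (B0 :: Bs) i)).
  apply: fin_bigcap_measurable => [|i /= isz]; first exact: finite_II.
  rewrite -[X in measurable X]setTI; apply: measurable_state => //.
  have : nth setT (B0 :: Bs) i \in B0 :: Bs by exact: mem_nth.
  by rewrite inE => /predU1P[->//|]; exact: mBs.
by apply/seteqP; split => om H i; apply: H.
Qed.

Lemma cylinder_sets_borel : cylinder_sets `<=` (@measurable _ (borel {ptws nat -> X})).
Proof.
move=> _ [B0 [Bs [mB0 mBs ->]]].
rewrite (_ : cylinder _ = \bigcap_(i in `I_(size (B0 :: Bs)))
    ((fun y : {ptws nat -> X} => y i) @^-1` nth setT (B0 :: Bs) i)).
  apply: fin_bigcap_measurable => [|i /= isz]; first exact: finite_II.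
  rewrite -[X in measurable X]setTI; apply: measurable_coordinate => //.
  have : nth setT (B0 :: Bs) i \in B0 :: Bs by exact: mem_nth.
  by rewrite inE => /predU1P[->//|]; exact: mBs.
by apply/seteqP; split => y H i; apply: H.
Qed.

(** Both laws agree on cylinders, which are stable under intersection. *)
Lemma path_distribution (mu : probability (borel {ptws nat -> X}) R) (S : set P) :
  path_law f nu pi0 mu -> measurable S ->
  [/\ measurable (S : set (borel {ptws nat -> X})),
      measurable ((fun om => x ^~ om) @^-1` S) &
      mu S = Pr ((fun om => x ^~ om) @^-1` S)].
Proof.
move=> law mS.
have mid : measurable_fun [set: borel {ptws nat -> X}] (id : borel {ptws nat -> X} -> P).
  apply: (@measurability _ _ (borel {ptws nat -> X}) P _ _ cylinder_sets) => //.
  by move=> _ [D cD <-]; rewrite setTI; exact: cylinder_sets_borel.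
split; first by have := mid measurableT S mS; rewrite setTI.
  by have := measurable_path measurableT mS; rewrite setTI.
(* The identity to the smaller sigma-algebra restricts mu to it. *)
pose idP : {mfun borel {ptws nat -> X} >-> P} := mfun_Sub (mem_set mid).
pose path : {mfun Omega >-> P} := mfun_Sub (mem_set measurable_path).
rewrite -[LHS]/(distribution mu idP S) -[RHS]/(distribution Pr path S).
have cover0 : cylinder_sets setT.
  rewrite (_ : setT = [set y : {ptws nat -> X} | [set: borel X] (y 0%N)]).
    exact: cylinder_coordinate.
  by apply/seteqP; split.
have cover : \bigcup_(_ : nat) [set: P] = setT by rewrite bigcup_const.
apply: (@measure_unique _ R P cylinder_sets (fun=> setT) erefl cylinder_setsI
  (fun=> cover0) cover (distribution mu idP) (distribution Pr path)) => //.
- by move=> _ [B0 [Bs [mB0 mBs ->]]]; exact: state_cylinder_law.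
- by move=> _; rewrite (le_lt_trans (probability_le1 _ _))// ltry.
Qed.

End noise.

(** * From state estimation to codes *)

Lemma measurable_mdist {R : realType} {X : completeMetricType R} (y : X) :
  measurable_fun [set: borel X] ((fun z => mdist y z) : borel X -> R).
Proof.
apply: (measurability _ (RGenInftyO.measurableE R)) => _ [_ [a ->] <-].
rewrite setTI (_ : _ @^-1` _ = ball y a).
  by apply: sub_sigma_algebra; exact: metric_ball_open.
by rewrite ballEmdist; apply/seteqP; split => z /=; rewrite in_itv.
Qed.

Lemma limn_esup_lt {R : realType} (u : nat -> \bar R) (e : \bar R) :
  (limn_esup u < e)%E -> exists T, forall t, (T <= t)%N -> (u t < e)%E.
Proof.
move=> /ereal_inf_lt[_ [V [T _ TV] <-] supV]; exists T => t Tt.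
apply: (le_lt_trans _ supV); apply: ereal_sup_ubound; exists t => //.
exact: TV.
Qed.

(** The coder is causal: later symbols do not alter earlier ones. *)
Lemma symbols_prefix {X : ptopologicalType} {M : nat} (g : coding_policy X M)
    (y : nat -> X) (s t : nat) :
  (s <= t)%N -> take s (symbols g y t) = symbols g y s :> seq _.
Proof.
elim: t => [|t IH]; first by rewrite leqn0 => /eqP ->.
rewrite leq_eqVlt => /predU1P[->|]; first by rewrite take_oversize ?size_tuple.
by rewrite ltnS => st /=; rewrite -cats1 takel_cat ?size_tuple// IH.
Qed.

Section estimation.
Context {R : realType} {X : completeMetricType R}
  {dO : measure_display} {Omega : measurableType dO}.
Variables (Pr : probability Omega R) (x : nat -> Omega -> X) (M : nat).
Hypothesis mx : forall t, measurable_fun [set: Omega] (x t : Omega -> borel X).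

(** Decompose according to the previous symbols and the new one, which take
    finitely many values. *)
Lemma measurable_symbols (g : coding_policy X M) t (q : t.-tuple 'I_M) :
  measurable_coding g -> measurable [set om | symbols g (x ^~ om) t = q].
Proof.
move=> mg; elim: t q => [|t IH] q.
  rewrite (_ : [set _ | _] = setT)//; apply/seteqP; split => // om _ /=.
  by rewrite [q]tuple0.
rewrite (_ : [set _ | _] = \bigcup_(p in [set p : t.-tuple 'I_M * 'I_M |
      [tuple of rcons p.1 p.2] = q])
    ([set om | symbols g (x ^~ om) t = p.1] `&`
     (fun om => [tuple x i om | i < t.+1]) @^-1`
       [set y : t.+1.-tuple (borel X) | g t y p.1 = p.2])).
  apply: fin_bigcup_measurable => [|[p m] _] /=.
    exact: finite_finset.
  apply: measurableI; first exact: IH.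
  rewrite -[X in measurable X]setTI.
  have mt : measurable_fun [set: Omega]
      ((fun om => [tuple x i om | i < t.+1]) : Omega -> t.+1.-tuple (borel X)).
    apply/measurable_fun_tnthP => i.
    rewrite (_ : _ \o _ = x i); first exact: mx.
    by apply/funext => om /=; rewrite tnth_mktuple.
  by apply: mt => //; exact: mg.
apply/seteqP; split => om /=.
  move=> <-; eexists (_, _) => /=; last by split; reflexivity.
  by [].
by move=> [[p m]] /= <- [-> ->].
Qed.

Variables (g : coding_policy X M) (gd : estimation_policy X M).
Hypothesis mg : measurable_coding g.

Lemma measurable_error t : measurable_fun [set: Omega]
  (fun om => (mdist (x t om) (estimate g gd (x ^~ om) t))%:E).
Proof.
apply/measurable_EFinP => _ B mB; rewrite setTI.
rewrite (_ : _ @^-1` _ = \bigcup_(q in [set: t.+1.-tuple 'I_M])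
   ([set om | symbols g (x ^~ om) t.+1 = q] `&`
    (x t @^-1` ((fun z => mdist (@gd t q) z) @^-1` B)))).
  apply: fin_bigcup_measurable => [|q _]; first exact: finite_finset.
  apply: measurableI; first exact: measurable_symbols.
  rewrite -[X in measurable X]setTI; apply: mx => //.
  by rewrite -[X in measurable X]setTI; exact: measurable_mdist.
apply/seteqP; split => om /=.
  move=> HB; exists (symbols g (x ^~ om) t.+1) => //; split => //=.
  by rewrite metric_sym.
by move=> [q _ [<- HB]]; rewrite /preimage/= metric_sym.
Qed.

(** The events of accuracy e from time T on increase with T, and their union
    contains the event that the limit superior is at most eps, which has
    probability 1. *)
Lemma eventually_accurate (eps e d : R) :
  objective_E2 Pr x g gd eps -> eps < e -> 0 < d ->
  exists2 T, measurable [set om | forall t, (T <= t)%N ->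
      mdist (x t om) (estimate g gd (x ^~ om) t) < e] &
    (Pr (~` [set om | forall t, (T <= t)%N ->
      (mdist (x t om) (estimate g gd (x ^~ om) t) < e)%R]) < d%:E)%E.
Proof.
rewrite /objective_E2; set L := (X in Pr X = _) => obj epse d0.
pose E T := [set om | forall t, (T <= t)%N ->
      mdist (x t om) (estimate g gd (x ^~ om) t) < e].
have mL : measurable L.
  rewrite -[L]setTI; apply: emeasurable_fun_infty_c => //.
  by apply: measurable_fun_limn_esup => t; exact: measurable_error.
have mE T : measurable (E T).
  rewrite (_ : E T = \bigcap_(t in [set t | (T <= t)%N])
      [set om | ((mdist (x t om) (estimate g gd (x ^~ om) t))%:E < e%:E)%E]).
    apply: bigcap_measurable => [|t _]; first by exists T => /=.
    rewrite -[X in measurable X]setTI; apply: emeasurable_fun_infty_o => //.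
    exact: measurable_error.
  by apply/seteqP; split => om H t Tt; have := H t Tt; rewrite /= lte_fin.
have LE : L `<=` \bigcup_T E T.
  move=> om /= Lom; have [|T HT] := @limn_esup_lt R _ e%:E (le_lt_trans Lom _).
    by rewrite lte_fin.
  by exists T => // t Tt; have := HT t Tt; rewrite lte_fin.
have mF T : measurable (E T `|` ~` L) by apply: measurableU => //; exact: measurableC.
have ndF n m : (n <= m)%N -> E n `|` ~` L `<=` E m `|` ~` L.
  by move=> nm; apply: setSU => om H t mt; apply: H; exact: leq_trans mt.
have FT : \bigcup_T (E T `|` ~` L) = setT.
  apply/seteqP; split => // om _; have [/LE[T _ ET]|nL] := pselect (L om).
    by exists T => //; left.
  by exists 0%N => //; right.
have [T small] := measure_exhaust Pr d0 mF ndF FT.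
exists T; first exact: mE.
rewrite -/(E T); apply: (le_lt_trans _ small).
have PL0 : Pr (~` L) = 0%E by rewrite probability_setC// obj subee.
have -> : Pr (setT `\` (E T `|` ~` L)) = (Pr (setT `\` (E T `|` ~` L)) + Pr (~` L))%E.
  by rewrite PL0 adde0.
apply: (le_trans _ (measureU2 _ _ _)); [|exact: measurableD|exact: measurableC].
apply: le_measure; rewrite ?inE.
- exact: measurableC.
- by apply: measurableU; [exact: measurableD|exact: measurableC].
- move=> om nE; have [Lom|nL] := pselect (L om); [left|by right].
  by split => // -[|].
Qed.

End estimation.

(** The reference paths are the outputs of the decoder on all N-tuples of
    symbols; the actual symbols provide the reference path close to the
    trajectory. The event that some reference path is close depends on
    finitely many coordinates only, so its probability can be computed under
    mu. *)
Lemma achievable_covered {R : realType} {X : completeMetricType R}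
    {dO : measure_display} {Omega : measurableType dO}
    (Pr : probability Omega R) (x : nat -> Omega -> X) (M : nat)
    (mu : probability (borel {ptws nat -> X}) R) :
  (forall t, measurable_fun [set: Omega] (x t : Omega -> borel X)) ->
  (forall S : set (g_sigma_algebraType (@cylinder_sets X)), measurable S ->
     [/\ measurable (S : set (borel {ptws nat -> X})),
         measurable ((fun om => x ^~ om) @^-1` S) &
         mu S = Pr ((fun om => x ^~ om) @^-1` S)]) ->
  (0 < M)%N ->
  achievable Pr x M -> covered_by_codes mu M.
Proof.
move=> mx law M0 ach e d e0 d0.
have e20 : 0 < e / 2 by rewrite divr_gt0.
have [g' [gd' [mg' obj]]] := ach _ e20.
have e2e : e / 2 < e by rewrite ltr_pdivrMr// ltr_pMr// ltr1n.
have [T mE small] := eventually_accurate mx mg' obj e2e d0.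
set E := [set om | _] in mE small.
exists T => N.
pose u0 : 'I_M := Ordinal M0.
(* Symbols beyond N are padded with u0; only times t < N matter. *)
pose y (u : N.-tuple 'I_M) (t : nat) : X := @gd' t [tuple nth u0 u i | i < t.+1].
pose G : set (g_sigma_algebraType (@cylinder_sets X)) :=
  \bigcup_(u in [set: N.-tuple 'I_M]) \bigcap_(t in [set t | (T <= t < N)%N])
    [set z : {ptws nat -> X} | ball (y u t) e (z t)].
have mG : measurable G.
  apply: fin_bigcup_measurable => [|u _]; first exact: finite_finset.
  apply: fin_bigcap_measurable => [|t _].
    by apply: (@sub_finite_set _ _ `I_N) => [t /= /andP[]//|]; exact: finite_II.
  rewrite -[X in measurable X]setTI.
  apply: (@measurable_cylinder_coordinate X t) => //.
  by apply: sub_sigma_algebra; exact: metric_ball_open.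
have [bG _ _] := law G mG.
exists (N.-tuple 'I_M), y, G; split.
- by rewrite card_tuple card_ord.
- exact: bG.
- have [_ mpG ->] := law (~` G) (measurableC mG).
  apply: (le_trans _ (ltW small)).
  apply: le_measure; rewrite ?inE//; first exact: measurableC.
  rewrite preimage_setC; apply: subsetC => om Eom.
  exists (symbols g' (x ^~ om) N) => // t /= /andP[Tt tN].
  rewrite ballEmdist/= metric_sym.
  have -> : y (symbols g' (x ^~ om) N) t = estimate g' gd' (x ^~ om) t.
    rewrite /y /estimate; congr (@gd' t _); apply: val_inj => /=.
    rewrite -[RHS](symbols_prefix g' (x ^~ om) tN).
    apply: (@eq_from_nth _ u0); rewrite size_map size_enum_ord.
      by rewrite size_takel// size_tuple.
    by move=> i it; rewrite (nth_map ord0) ?size_enum_ord// nth_enum_ord// nth_take.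
  exact: Eom.
- move=> z [u _ Gz]; exists u => t tTN.
  by have := Gz t tTN; rewrite /= ballEmdist/= metric_sym.
Qed.

Theorem mainTheorem2 (R : realType) (X : completeMetricType R)
    (dW : measure_display) (W : measurableType dW) (f : X -> W -> X)
    (nu : probability W R) (pi0 : probability (borel X) R)
    (dO : measure_display) (Omega : measurableType dO)
    (Pr : probability Omega R) (x0 : Omega -> X) (w : nat -> Omega -> W)
    (mu : probability (borel {ptws nat -> X}) R) :
  measurable_fun [set: borel X * W]
    ((fun p => f p.1 p.2) : borel X * W -> borel X) ->
  (forall v : W, homeomorphism (f ^~ v)) ->
  driving_noise Pr pi0 nu (x0 : Omega -> borel X) w ->
  stationary f nu pi0 ->
  ergodic f nu pi0 ->
  path_law f nu pi0 mu ->
  invariant_measure mu left_shift ->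
  compact (supp mu) ->
  (metric_entropy mu left_shift <=
     C0 Pr (fun t om => trajectory f (x0 om) (w ^~ om) t))%E.
Proof.
move=> mf _ noise _ _ law inv _.
set x := fun t om => trajectory f (x0 om) (w ^~ om) t.
apply: le_ereal_inf_tmp => _ [M [M0 ach ->]].
apply: ge_ereal_sup => _ [k [A [partA ->]]]; rewrite lee_fin.
have cov : covered_by_codes mu M.
  apply: (@achievable_covered R X dO Omega Pr x M) => //.
    by move=> t; exact: (measurable_state mf noise).
  by move=> S mS; exact: (path_distribution mf noise law mS).
(* A partition has at least one cell, since there is at least one path. *)
case: k A partA => [|k] A partA; last exact: partition_entropy_le_log.
by case: partA => _ _ cA; have : [set: {ptws nat -> X}] point by []; rewrite -cA => -[[]].
Qed.
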